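(* If $F$ is a linked field with $\operatorname{char}(F)=2$, then $I_q^4F=0$.
   Context: A quaternion algebra over $F$ is a central simple $F$-algebra of degree $2$. Two quaternion $F$-algebras are linked if they share a common maximal subfield. A field $F$ is linked if every two quaternion $F$-algebras are linked. Let $\operatorname{char}(F)=2$. A quadratic form over $F$ is a map $\varphi:V\to F$ on a finite-dimensional $F$-vector space $V$ with $\varphi(av)=a^2\varphi(v)$ for all $a\in F$, $v\in V$, such that $B_\varphi(v,w)=\varphi(v+w)-\varphi(v)-\varphi(w)$ is bilinear; it is nonsingular if $B_\varphi$ is nondegenerate. For $\alpha,\beta\in F$, $[\alpha,\beta]$ denotes the quadratic form $\alpha x^2+xy+\beta y^2$. The hyperbolic plane is $[0,0]$, and a hyperbolic form is an orthogonal sum of hyperbolic planes. Two nonsingular quadratic forms are Witt equivalent if their orthogonal sum is hyperbolic. The Witt equivalence classes of nonsingular quadratic forms form an abelian group $I_qF$ under orthogonal sum $\perp$. $\langle\alpha_1,\dots,\alpha_n\rangle$ denotes the diagonal bilinear form $(x,y)\mapsto\sum_i\alpha_ix_iy_i$. For a symmetric bilinear form $B$ on $V$ and a quadratic form $\varphi$ on $W$, $B\otimes\varphi$ is the quadratic form on $V\otimes_FW$ with $(B\otimes\varphi)(v\otimes w)=B(v,v)\varphi(w)$ and polar form $B\otimes B_\varphi$. A quadratic $n$-fold Pfister form is a form $\langle\langle\alpha_1,\dots,\alpha_{n-1},\beta]]:=\langle1,\alpha_1\rangle\otimes\cdots\otimes\langle1,\alpha_{n-1}\rangle\otimes[1,\beta]$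 with $\alpha_i\in F^\times$, $\beta\in F$. $I_q^nF$ is the subgroup of $I_qF$ generated by the classes of scalar multiples (by elements of $F^\times$) of quadratic $n$-fold Pfister forms over $F$. *)

(* Defs.v *)
From HB Require Import structures.
From mathcomp Require Import all_boot all_algebra all_field.
From mathcomp Require Import ring.

Set Implicit Arguments.
Unset Strict Implicit.
Unset Printing Implicit Defensive.

Import GRing.Theory.
Local Open Scope ring_scope.

Section QuaternionAlgebras.
Variable F : fieldType.

(* Two-sided ideals of a unital F-algebra are automatically F-subspaces. *)
Definition two_sided_ideal (A : falgType F) (I : {vspace A}) : Prop :=
  (({:A} * I) <= I)%VS /\ ((I * {:A}) <= I)%VS.

Definition central_simple (A : falgType F) : Prop :=
  'Z({:A})%VS = 1%VS /\
  forall I : {vspace A}, two_sided_ideal I -> I = 0%VS \/ I = {:A}%VS.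

(* The degree of a central simple algebra is the square root of its
   dimension. *)
Definition quaternion_algebra (A : falgType F) : Prop :=
  central_simple A /\ \dim {:A} = (2 ^ 2)%N.

(* The unit of an {aspace A} need not be that of A, so 1 \in K is required. *)
Definition is_subfield (A : falgType F) (K : {aspace A}) : Prop :=
  [/\ 1 \in K,
      {in K &, forall x y, x * y = y * x} &
      {in K, forall x, x != 0 -> exists2 y, y \in K & x * y = 1}].

Definition maximal_subfield (A : falgType F) (K : {aspace A}) : Prop :=
  is_subfield K /\
  forall L : {aspace A}, is_subfield L -> (K <= L)%VS -> L = K.

(* A common maximal subfield is a pair of maximal subfields that are isomorphic
   as F-algebras; f is only relevant on K. *)
Definition linked (A B : falgType F) : Prop :=
  exists (K : {aspace A}) (L : {aspace B}),
    [/\ maximal_subfield K, maximal_subfield L &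
        exists f : 'Hom(A, B),
          [/\ ahom_in K f, {in K &, injective f} & (f @: K)%VS = L]].

Definition linked_field : Prop :=
  forall A B : falgType F,
    quaternion_algebra A -> quaternion_algebra B -> linked A B.

End QuaternionAlgebras.

Section QuadraticForms.
Variable F : fieldType.

Definition polar (V : vectType F) (q : V -> F) (v w : V) : F :=
  q (v + w) - q v - q w.

Record qform := QForm {
  qspace : vectType F;
  qmap :> qspace -> F;
  qformZ : forall (a : F) (v : qspace), qmap (a *: v) = a ^+ 2 * qmap v;
  qform_polar : bilinear_for *%R *%R (polar qmap)
}.

Definition nonsingular (phi : qform) : Prop :=
  forall v : qspace phi, (forall w, polar phi v w = 0) -> v = 0.

Definition isometric (phi psi : qform) : Prop :=
  exists f : {linear qspace phi -> qspace psi},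
    bijective f /\ forall v, psi (f v) = phi v.

Section Zero.

Definition zero_map (v : 'rV[F]_0) : F := 0.

Fact zero_mapZ a v : zero_map (a *: v) = a ^+ 2 * zero_map v.
Proof. by rewrite /zero_map mulr0. Qed.

Fact zero_polar : bilinear_for *%R *%R (polar zero_map).
Proof. by split=> u a v w; rewrite /polar /zero_map /=; ring. Qed.

Definition qzero : qform := QForm zero_mapZ zero_polar.

End Zero.

Section Binary.
Variables a b : F.

Definition binary_map (v : F^o * F^o) : F :=
  a * v.1 ^+ 2 + v.1 * v.2 + b * v.2 ^+ 2.

Fact binary_mapZ c v : binary_map (c *: v) = c ^+ 2 * binary_map v.
Proof. by rewrite /binary_map /= /GRing.scale /=; ring. Qed.

Fact binary_polar : bilinear_for *%R *%R (polar binary_map).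
Proof.
by split=> u c v w; rewrite /polar /binary_map /= /GRing.scale /=; ring.
Qed.

Definition qbinary : qform := QForm binary_mapZ binary_polar.

End Binary.

Section Perp.
Variables phi psi : qform.

Definition perp_map (v : qspace phi * qspace psi) : F := phi v.1 + psi v.2.

Fact perp_mapZ c v : perp_map (c *: v) = c ^+ 2 * perp_map v.
Proof. by rewrite /perp_map !qformZ mulrDr. Qed.

Lemma polar_perp v w :
  polar perp_map v w = polar phi v.1 w.1 + polar psi v.2 w.2.
Proof. by rewrite /polar /perp_map /=; ring. Qed.

Fact perp_polar : bilinear_for *%R *%R (polar perp_map).
Proof.
have [lphi rphi] := qform_polar phi; have [lpsi rpsi] := qform_polar psi.
split=> u c v w; rewrite !polar_perp /=.
  by rewrite lphi lpsi /=; ring.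
by rewrite rphi rpsi /=; ring.
Qed.

Definition qperp : qform := QForm perp_mapZ perp_polar.

End Perp.

Section Scale.
Variables (c : F) (phi : qform).

Definition scale_map (v : qspace phi) : F := c * phi v.

Fact scale_mapZ a v : scale_map (a *: v) = a ^+ 2 * scale_map v.
Proof. by rewrite /scale_map qformZ mulrCA. Qed.

Lemma polar_scale v w : polar scale_map v w = c * polar phi v w.
Proof. by rewrite /polar /scale_map; ring. Qed.

Fact scale_polar : bilinear_for *%R *%R (polar scale_map).
Proof.
have [lphi rphi] := qform_polar phi.
split=> u a v w; rewrite !polar_scale.
  by rewrite lphi /=; ring.
by rewrite rphi /=; ring.
Qed.

Definition qscale : qform := QForm scale_mapZ scale_polar.

End Scale.

(* <a_1, ..., a_n> (x) phi, on F^n (x) W realised as W^n, the pure tensor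
   x (x) w being (x_1 w, ..., x_n w). *)
Section DiagonalTensor.
Variables (n : nat) (a : n.-tuple F) (phi : qform).

Definition tensor_map (w : {ffun 'I_n -> qspace phi}) : F :=
  \sum_(i < n) tnth a i * phi (w i).

Fact tensor_mapZ c w : tensor_map (c *: w) = c ^+ 2 * tensor_map w.
Proof.
rewrite /tensor_map mulr_sumr; apply: eq_bigr => i _.
by rewrite ffunE qformZ; ring.
Qed.

Lemma polar_tensor v w :
  polar tensor_map v w = \sum_(i < n) tnth a i * polar phi (v i) (w i).
Proof.
rewrite /polar /tensor_map -!sumrB; apply: eq_bigr => i _.
by rewrite ffunE; ring.
Qed.

Fact tensor_polar : bilinear_for *%R *%R (polar tensor_map).
Proof.
have [lphi rphi] := qform_polar phi.
split=> u c v w; rewrite !polar_tensor /= mulr_sumr -big_split /=;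
  apply: eq_bigr => i _; rewrite !ffunE.
  by rewrite lphi /=; ring.
by rewrite rphi /=; ring.
Qed.

Definition qtensor : qform := QForm tensor_mapZ tensor_polar.

Definition diag_bilin (x y : 'I_n -> F) : F :=
  \sum_(i < n) tnth a i * x i * y i.

Definition pure_tensor (x : 'I_n -> F) (w : qspace phi) : qspace qtensor :=
  [ffun i => x i *: w].

Lemma qtensor_pure x w : qtensor (pure_tensor x w) = diag_bilin x x * phi w.
Proof.
rewrite /= /tensor_map /diag_bilin mulr_suml; apply: eq_bigr => i _.
by rewrite ffunE qformZ; ring.
Qed.

Lemma polar_qtensor_pure x y v w :
  polar qtensor (pure_tensor x v) (pure_tensor y w)
    = diag_bilin x y * polar phi v w.
Proof.
have [lphi rphi] := qform_polar phi.
rewrite /= polar_tensor /diag_bilin mulr_suml; apply: eq_bigr => i _.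
have lZ c u u' : polar phi (c *: u) u' = c * polar phi u u'.
  have l0 : polar phi 0 u' = 0.
    by have := lphi u' (-1) 0 0; rewrite /= scaler0 addr0 mulN1r addNr.
  by have := lphi u' c u 0; rewrite /= addr0 l0 addr0.
have rZ c u u' : polar phi u (c *: u') = c * polar phi u u'.
  have r0 : polar phi u 0 = 0.
    by have := rphi u (-1) 0 0; rewrite /= scaler0 addr0 mulN1r addNr.
  by have := rphi u c u' 0; rewrite /= addr0 r0 addr0.
by rewrite !ffunE lZ rZ; ring.
Qed.

End DiagonalTensor.

(* <<a_1, ..., a_m, b]], with m + 1 the fold number. *)
Definition pfister (a : seq F) (b : F) : qform :=
  foldr (fun x phi => qtensor [tuple 1; x] phi) (qbinary 1 b) a.

Definition qhyperbolic (phi : qform) : Prop :=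
  exists n : nat, isometric phi (iter n (qperp (qbinary 0 0)) qzero).

Definition witt_equiv (phi psi : qform) : Prop := qhyperbolic (qperp phi psi).

(* Iq n phi: phi is nonsingular and its Witt class lies in I_q^n F. A subgroup
   of I_q F is represented by the Witt-saturated collection of the nonsingular
   forms whose class belongs to it; Iq n is the smallest such collection
   containing the generators. As the inverse of the class of phi is the class
   of any psi with qperp phi psi hyperbolic, closure under inverses is
   literally the same rule as saturation, Iq_witt. *)
Inductive Iq (n : nat) : qform -> Prop :=
| Iq_gen (c : F) (a : seq F) (b : F) :
    c != 0 -> all (fun x => x != 0) a -> (size a).+1 = n ->
    Iq n (qscale c (pfister a b))
| Iq_zero : Iq n qzero
| Iq_perp phi psi : Iq n phi -> Iq n psi -> Iq n (qperp phi psi)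
| Iq_witt phi psi :
    Iq n phi -> nonsingular psi -> witt_equiv phi psi -> Iq n psi.

Lemma Iq_nonsingular n phi : 2%N \in [pchar F] -> Iq n phi -> nonsingular phi.
Proof.
move=> char2; have two0 : (2%:R : F) = 0 by rewrite pcharf0.
have polar0 (chi : qform) (u : qspace chi) : polar chi u 0 = 0.
  have [_ rchi] := qform_polar chi.
  by have := rchi u (-1) 0 0; rewrite /= scaler0 addr0 mulN1r addNr.
elim=> [c a b c0 a0 _||{}phi psi _ IHphi _ IHpsi|//].
- suff ns : nonsingular (pfister a b).
    move=> v v0; apply: ns => w; have := v0 w; rewrite /= polar_scale.
    by move/eqP; rewrite mulf_eq0 (negPf c0) => /eqP.
  elim: a a0 => [_|x a IH /= /andP[x0 /IH ns]].
    move=> [v1 v2] v0; have := v0 (1, 0); have := v0 (0, 1).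
    rewrite /= /polar /binary_map /= => h1 h2; congr pair.
      rewrite -h1; ring: two0.
    rewrite -h2; ring: two0.
  move=> v v0; apply/ffunP => i; rewrite ffunE; apply: ns => w.
  have := v0 [ffun j => if j == i then w else 0].
  rewrite /= polar_tensor (bigD1 i) //= big1 => [|j /negPf ji]; last first.
    by rewrite ffunE ji polar0 mulr0.
  rewrite ffunE (eqxx i) addr0 => /eqP; rewrite mulf_eq0 => /orP[|/eqP //].
  by case: i => [[|[|//]] ?]; rewrite !(tnth_nth 0) /= ?oner_eq0 ?(negPf x0).
- by move=> v _; rewrite [v]thinmx0.
- move=> [v1 v2] v0; congr pair.
    apply: IHphi => w; have := v0 (w, 0).
    by rewrite /= polar_perp /= polar0 addr0.
  apply: IHpsi => w; have := v0 (0, w).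
  by rewrite /= polar_perp /= polar0 add0r.
Qed.

Definition Iq_trivial (n : nat) : Prop :=
  forall phi : qform, Iq n phi -> witt_equiv phi qzero.

End QuadraticForms.

(* Main.v *)
Require Import Defs.
From HB Require Import structures.
From mathcomp Require Import all_boot all_algebra all_field.
From mathcomp Require Import ring zify.
From Stdlib Require Import Classical.

(** Write N_a(x, y) = x^2 + xy + ay^2 for the form [1, a], and [a, b) for the
    quaternion algebra generated by i and j with i^2 + i = a, j^2 = b and
    ij = j(i + 1); its norm form is the Pfister form <<b, a]].

    Linkage enters through Albert forms.  If [a, b) and [c, d) contain
    isomorphic quadratic extensions of F, corresponding generators have the
    same reduced trace and the same reduced norm.  Written in coordinates this
    says that N_a(u, v) + b N_a(p) = N_c(u', v) + d N_c(q) for some u, u', v, p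
    and q with (v, p) <> 0 ([linked_albert_isotropic]).  In characteristic 2
    this is a nontrivial zero of the Albert form
    [1, a + c] _|_ b [1, a] _|_ d [1, c].

    The heart of the proof is that every fourfold Pfister form <<t, s, r, a]]
    contains such an Albert form.  Put y = 1 + a/t and c = t a y^2.  The form
    N_a _|_ t N_a represents 1 at (1, 0) in the first copy; adding (0, y) in
    the second copy to (0, 1) in the first raises the value a to a + c, so it
    contains [1, a + c].  Likewise adding (1, y) in the copy rt N_a to (0, 1)
    in the copy r N_a yields r [1, a + t N_a(1, y)], which is r [1, c] because
    t + ty = a.  Together with s N_a these planes are mutually orthogonal and
    form the Albert form of [a, s) and [c, r).  Hence over a linked field every
    fourfold Pfister form is isotropic ([linked_pfister_isotropic]).

    Isotropic Pfister forms are hyperbolic because Pfister forms are round: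
    their nonzero values are similarity factors ([pfister_round]).  If
    phi(p) + x phi(q) = 0 with phi(q) <> 0, then x is a similarity factor of
    phi and the graph of a similarity is a totally isotropic subspace of
    phi _|_ x phi of half the dimension.

    Hyperbolicity is handled throughout by such subspaces (Lagrangians): a
    nonsingular form is hyperbolic if and only if it has one
    ([hyperbolic_has_lagrangian], [lagrangian_hyperbolic]).  They pass to
    orthogonal sums, and symplectic reduction shows that they can be cancelled
    ([lagrangian_cancel]); the latter is what makes the class of hyperbolic
    forms stable under Witt equivalence, so that the triviality of the
    generators of I_q^4 implies the triviality of the whole group. *)

Set Implicit Arguments.
Unset Strict Implicit.
Unset Printing Implicit Defensive.

Import GRing.Theory.
Local Open Scope ring_scope.

(** * Quaternion algebras *)

Lemma even_numerals0 (F : fieldType) : 2%N \in [pchar F] ->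
  [/\ 2%:R = 0 :> F, -2%:R = 0 :> F, 4%:R = 0 :> F & -4%:R = 0 :> F].
Proof.
move=> char2; have two0 : 2%:R = 0 :> F by exact: pcharf0.
by rewrite (natrM _ 2 2) two0 mul0r oppr0.
Qed.

(** Equality of ring expressions up to signs and even coefficients: the
    coefficients of the difference of both sides are cancelled through the four
    equations given to [ring], which cover all values occurring below. *)
Ltac char2_ring char2 :=
  apply/subr0_eq;
  let p2 := fresh in let m2 := fresh in let p4 := fresh in let m4 := fresh in
  case: (even_numerals0 char2) => p2 m2 p4 m4; ring: p2 m2 p4 m4.

Section Quaternion.
Variable F : fieldType.

(** The algebra [a, b): ((x0, x1), (x2, x3)) stands for z + wj with
    z = x0 + x1 i and w = x2 + x3 i.  The relations are written with signs,
    i^2 = i - a, j^2 = b and j z = z' j for the conjugation z' sending i to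
    1 - i, so that the ring axioms are polynomial identities over any field. *)
Definition quat (a b : F) : Type := ((F^o * F^o) * (F^o * F^o))%type.

Variables a b : F.

HB.instance Definition _ :=
  Vector.copy (quat a b) ((F^o * F^o) * (F^o * F^o))%type.

Definition qmk (x0 x1 x2 x3 : F) : quat a b := ((x0, x1), (x2, x3)).

Lemma quat_ext (x y : quat a b) :
  x.1.1 = y.1.1 -> x.1.2 = y.1.2 -> x.2.1 = y.2.1 -> x.2.2 = y.2.2 -> x = y.
Proof. by case: x y => [[? ?] [? ?]] [[? ?] [? ?]] /= -> -> -> ->. Qed.

Definition quat_one : quat a b := qmk 1 0 0 0.

Definition quat_mul (x y : quat a b) : quat a b :=
  let: (x0, x1, (x2, x3)) := x in
  let: (y0, y1, (y2, y3)) := y in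
  qmk (x0 * y0 - a * x1 * y1 + b * (x2 * (y2 + y3) + a * x3 * y3))
      (x0 * y1 + x1 * y0 + x1 * y1 + b * (x3 * y2 - x2 * y3))
      (x0 * y2 - a * x1 * y3 + x2 * (y0 + y1) + a * x3 * y1)
      (x0 * y3 + x1 * y2 + x1 * y3 + x3 * y0 - x2 * y1).

Fact quat_mulA : associative quat_mul.
Proof.
case=> [[x0 x1] [x2 x3]] [[y0 y1] [y2 y3]] [[z0 z1] [z2 z3]].
by apply: quat_ext => /=; ring.
Qed.
Fact quat_mul1l : left_id quat_one quat_mul.
Proof. by case=> [[x0 x1] [x2 x3]]; apply: quat_ext => /=; ring. Qed.
Fact quat_mul1r : right_id quat_one quat_mul.
Proof. by case=> [[x0 x1] [x2 x3]]; apply: quat_ext => /=; ring. Qed.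
Fact quat_mulDl : left_distributive quat_mul +%R.
Proof.
case=> [[x0 x1] [x2 x3]] [[y0 y1] [y2 y3]] [[z0 z1] [z2 z3]].
by apply: quat_ext => /=; ring.
Qed.
Fact quat_mulDr : right_distributive quat_mul +%R.
Proof.
case=> [[x0 x1] [x2 x3]] [[y0 y1] [y2 y3]] [[z0 z1] [z2 z3]].
by apply: quat_ext => /=; ring.
Qed.
Fact quat_one_neq0 : quat_one != 0.
Proof. by apply/eqP => /(congr1 (fun x => x.1.1)) /eqP; rewrite /= oner_eq0. Qed.

HB.instance Definition _ := GRing.Zmodule_isNzRing.Build (quat a b)
  quat_mulA quat_mul1l quat_mul1r quat_mulDl quat_mulDr quat_one_neq0.

Fact quat_scaleAl c (x y : quat a b) : c *: (x * y) = (c *: x : quat a b) * y.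
Proof.
case: x y => [[x0 x1] [x2 x3]] [[y0 y1] [y2 y3]].
by apply: quat_ext; rewrite /= /GRing.scale /=; ring.
Qed.
Fact quat_scaleAr c (x y : quat a b) : c *: (x * y) = x * (c *: y : quat a b).
Proof.
case: x y => [[x0 x1] [x2 x3]] [[y0 y1] [y2 y3]].
by apply: quat_ext; rewrite /= /GRing.scale /=; ring.
Qed.
HB.instance Definition _ :=
  GRing.Lmodule_isLalgebra.Build F (quat a b) quat_scaleAl.
HB.instance Definition _ :=
  GRing.Lalgebra_isAlgebra.Build F (quat a b) quat_scaleAr.
HB.instance Definition _ := Algebra_isFalgebra.Build F (quat a b).

(** Reduced trace and reduced norm. *)
Definition qtr (x : quat a b) : F := x.1.1 *+ 2 + x.1.2.
Definition qnrd (x : quat a b) : F :=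
  binary_map 1 a x.1 - b * binary_map 1 a x.2.

Lemma quat_sqr x : x * x = qtr x *: x - (qnrd x)%:A.
Proof.
case: x => [[x0 x1] [x2 x3]]; rewrite /qtr /qnrd /binary_map.
by apply: quat_ext; rewrite /= /GRing.scale /=; ring.
Qed.

Lemma quat_dim : \dim {:quat a b} = 4.
Proof. by rewrite dimvf. Qed.

Lemma quat_scalarE c : c%:A = qmk c 0 0 0 :> quat a b.
Proof. by apply: quat_ext; rewrite /= /GRing.scale /= ?mulr0 ?mulr1. Qed.

Lemma mem_quat1 (x : quat a b) :
  (x \in 1%VS) = (x.1.2 == 0) && (x.2 == 0).
Proof.
apply/idP/andP => [/vlineP[k ->]|[/eqP x12 /eqP x2]].
  by rewrite quat_scalarE.
have -> : x = x.1.1%:A by rewrite quat_scalarE; apply: quat_ext; rewrite ?x2.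
exact/rpredZ/memv_line.
Qed.

Hypothesis char2 : 2%N \in [pchar F].

Let qi : quat a b := qmk 0 1 0 0.
Let qj : quat a b := qmk 0 0 1 0.

(** Brackets with i and j isolate coordinates; they are how the centre and the
    two-sided ideals are computed. *)
Lemma quat_bracket_i x : qi * x - x * qi = qmk 0 0 x.2.1 x.2.2.
Proof.
by case: x => [[x0 x1] [x2 x3]]; apply: quat_ext => /=; char2_ring char2.
Qed.

Lemma quat_bracket_j x : (qj * x - x * qj) * qj = qmk (b * x.1.2) 0 (b * x.2.2) 0.
Proof.
by case: x => [[x0 x1] [x2 x3]]; apply: quat_ext => /=; char2_ring char2.
Qed.

Lemma quat_centralizer_i x : (x \in 'C[qi])%VS = (x.2 == 0).
Proof.
apply/cent1vP/eqP => [xi|].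
  have := quat_bracket_i x; rewrite xi subrr => /(congr1 snd) /=.
  by case: (x.2) => [u v] <-.
by case: x => [[x0 x1] ?] /= ->; apply: quat_ext => /=; char2_ring char2.
Qed.

Hypothesis b0 : b != 0.

(** A central element has zero brackets with i and j, hence is scalar.  From any
    nonzero element of a two-sided ideal, brackets and multiplications by j
    produce a nonzero scalar. *)
Lemma quat_quaternion_algebra : quaternion_algebra (quat a b).
Proof.
split; last exact: quat_dim.
split.
  apply/eqP; rewrite eqEsubv; apply/andP; split.
    apply/subvP => x /memv_capP[_ /centvP cx].
    have := quat_bracket_i x; rewrite -cx ?memvf // subrr => xi.
    have := quat_bracket_j x; rewrite -cx ?memvf // subrr mul0r => xj.
    have [x21 x22] : x.2.1 = 0 /\ x.2.2 = 0 by case: xi.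
    have /esym/eqP : 0 = b * x.1.2 by case: xj.
    rewrite mulf_eq0 (negPf b0) /= => /eqP x12.
    by rewrite mem_quat1 x12 eqxx /=; apply/eqP; case: (x.2) x21 x22 => ? ? /= -> ->.
  apply/subvP => _ /vlineP[k ->]; apply: rpredZ.
  by rewrite memv_cap memvf; apply/centvP => v _; rewrite mul1r mulr1.
move=> I [/prodvP lI /prodvP rI].
have {}lI x y : y \in I -> x * y \in I by move=> Iy; rewrite lI ?memvf.
have {}rI x y : x \in I -> x * y \in I by move=> Ix; rewrite rI ?memvf.
have Iscal c : c != 0 -> qmk c 0 0 0 \in I -> I = {:quat a b}%VS.
  rewrite -quat_scalarE => c0 Ic; apply/eqP; rewrite eqEsubv subvf /=.
  apply/subvP => x _; rewrite -[x]mul1r; apply: rI.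
  by rewrite -[1](scalerK c0) memvZ.
have Ib x : x \in I -> (qj * x - x * qj) * qj \in I.
  by move=> Ix; apply/rI/memvB; [apply: lI | apply: rI].
have Ib' x : x \in I -> qi * x - x * qi \in I.
  by move=> Ix; apply: memvB; [apply: lI | apply: rI].
have [/eqP|] := eqVneq (vpick I) 0; first by rewrite vpick0 => /eqP; left.
move: (memv_pick I); move: (vpick I) => x Ix x0; right.
have [x3|x3] := eqVneq x.2.2 0; last first.
  have := Ib' _ (Ib _ Ix); rewrite quat_bracket_j quat_bracket_i /=.
  move/(rI _ qj) => Iy; apply: (Iscal (b * (b * x.2.2))).
    by rewrite !mulf_neq0.
  move: Iy; congr (is_true (_ \in I)); apply: quat_ext => /=; char2_ring char2.
have [x1|x1] := eqVneq x.1.2 0; last first.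
  have := Ib _ Ix; rewrite quat_bracket_j x3 mulr0.
  by apply: Iscal; rewrite mulf_neq0.
have [x2|x2] := eqVneq x.2.1 0; last first.
  have := Ib' _ Ix; rewrite quat_bracket_i x3.
  move/(rI _ qj) => Iy; apply: (Iscal (b * x.2.1)).
    by rewrite mulf_neq0.
  move: Iy; congr (is_true (_ \in I)); apply: quat_ext => /=; char2_ring char2.
apply: (Iscal x.1.1).
  by apply: contraNneq x0 => x0; apply/eqP/quat_ext.
by move: Ix; congr (is_true (_ \in I)); apply: quat_ext.
Qed.

(** If N_a is anisotropic, then F(i) is a field, so that F itself is not a maximal
    subfield.  In the split case F can be one, for instance when it is
    quadratically closed. *)
Lemma maximal_subfield_nonscalar (K : {aspace quat a b}) :
    (forall z, binary_map 1 a z = 0 -> z = 0) -> maximal_subfield K ->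
  exists2 x, x \in K & x \notin 1%VS.
Proof.
move=> aniso [[K1 _ _] maxK]; apply/subvPn/negP => sK1.
have sKC : (K <= 'C[qi])%VS.
  apply: subv_trans sK1 _; apply/subvP => _ /vlineP[k ->].
  by apply/rpredZ/cent1v1.
have : is_subfield 'C[qi]%AS.
  split; first exact: cent1v1.
    move=> x y; rewrite !quat_centralizer_i.
    case: x y => [[x0 x1] ?] [[y0 y1] ?] /= /eqP -> /eqP ->.
    by apply: quat_ext => /=; ring.
  move=> x; rewrite quat_centralizer_i.
  case: x => [[x0 x1] ?] /= /eqP -> xn0.
  pose n := binary_map 1 a (x0, x1).
  have n0 : n != 0 by apply: contraNneq xn0 => /aniso [-> ->].
  exists (qmk ((x0 + x1) / n) (- x1 / n) 0 0); first by rewrite quat_centralizer_i.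
  have nE : x0 * (x0 + x1) + a * x1 * x1 = n by rewrite /n /binary_map /=; ring.
  apply: quat_ext => /=.
  - transitivity ((x0 * (x0 + x1) + a * x1 * x1) / n); first by ring.
    by rewrite nE divff.
  - by ring.
  - by ring.
  by ring.
move/maxK/(_ sKC) => CK.
have : qi \in K by rewrite -CK cent1v_id.
by move/(subvP sK1); rewrite mem_quat1 oner_eq0.
Qed.

End Quaternion.

(** * Linkage and Albert forms *)

Section Link.
Variable F : fieldType.

(** A nonscalar element and 1 are linearly independent, so its quadratic equation
    is unique. *)
Lemma quat_reduced_unique (a b : F) (x : quat a b) t n :
  x \notin 1%VS -> x * x = t *: x - n%:A -> t = qtr x /\ n = qnrd x.
Proof.
move=> xn1; rewrite quat_sqr => xx.
have e : (t - qtr x) *: x = (n - qnrd x)%:A.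
  have -> : (t - qtr x) *: x = t *: x - qtr x *: x by rewrite scalerBl.
  by rewrite -[t *: x](subrK n%:A) -xx addrC !addrA addNr add0r addrC -scalerBl.
have /eqP t0 : t - qtr x == 0.
  apply: contraNT xn1 => t0.
  by rewrite -[x](scalerK t0) e !rpredZ ?memv_line.
split; first exact: subr0_eq.
move: e; rewrite t0 scale0r => /esym/eqP; rewrite scaler_eq0 oner_eq0 orbF.
by move/eqP/subr0_eq.
Qed.

Hypothesis char2 : 2%N \in [pchar F].

(** An isomorphism f of maximal subfields maps a nonscalar x to a nonscalar f x
    with the same quadratic equation.  The number v is the common trace, the
    equation is the equality of the reduced norms, and (v, p) <> 0 because x is
    not scalar. *)
Lemma linked_albert_isotropic (a b c d : F) :
    linked (quat a b) (quat c d) ->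
    (forall z, binary_map 1 a z = 0 -> z = 0) ->
  exists u u' v p q,
    binary_map 1 a (u, v) + b * binary_map 1 a p =
      binary_map 1 c (u', v) + d * binary_map 1 c q /\ (v, p) <> 0.
Proof.
move=> [K [L [maxK _ [f [/ahom_inP[fM f1] f_inj _]]]]] aniso.
have [x Kx xn1] := maximal_subfield_nonscalar char2 aniso maxK.
have [[K1 _ _] _] := maxK.
have fxn1 : f x \notin 1%VS.
  apply: contraNN xn1 => /vlineP[k fx]; apply/vlineP; exists k.
  by apply: f_inj; rewrite ?rpredZ // linearZ /= f1.
have : f x * f x = qtr x *: f x - (qnrd x)%:A.
  by rewrite -fM // quat_sqr linearB !linearZ /= f1.
case/(quat_reduced_unique fxn1) => trE nrdE.
have dbl0 (z : F) : z *+ 2 = 0 by rewrite -mulr_natr pcharf0 ?mulr0.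
move: (f x) trE nrdE => y trE nrdE.
have {}trE : x.1.2 = y.1.2.
  by move: trE; rewrite /qtr !dbl0 !add0r.
exists x.1.1, y.1.1, x.1.2, x.2, y.2; split.
  have -> : (x.1.1, x.1.2) = x.1 by case: (x.1).
  have -> : (y.1.1, x.1.2) = y.1 by rewrite trE; case: (y.1).
  by move: nrdE; rewrite /qnrd !(oppr_pchar2 char2).
move=> e; case/negP: xn1; rewrite mem_quat1.
by rewrite -[x.1.2]/(x.1.2, x.2).1 -{2}[x.2]/(x.1.2, x.2).2 e !eqxx.
Qed.

End Link.

(** * Polar forms and Lagrangians *)

Section Forms.
Variable F : fieldType.
Implicit Types phi psi : qform F.

Lemma linear_lfun (V W : vectType F) (f : V -> W) :
  linear f -> exists g : 'Hom(V, W), g =1 f.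
Proof.
move=> lf.
pose fl : {linear V -> W} := HB.pack f (GRing.isLinear.Build _ _ _ _ f lf).
by exists (linfun fl) => v; rewrite lfunE.
Qed.

Section Polar.
Variable phi : qform F.
Implicit Types u v w : qspace phi.

Lemma qformD u v : phi (u + v) = phi u + phi v + polar phi u v.
Proof. by rewrite /polar; ring. Qed.

Lemma polarC u v : polar phi u v = polar phi v u.
Proof. by rewrite /polar (addrC u) addrAC. Qed.

Lemma qform0 : phi 0 = 0.
Proof. by have := qformZ 0 (0 : qspace phi); rewrite scale0r expr0n mul0r. Qed.

Lemma polarPr a u v w : polar phi u (a *: v + w) = a * polar phi u v + polar phi u w.
Proof. by have [_ ->] := qform_polar phi. Qed.

Lemma polar0r u : polar phi u 0 = 0.
Proof. by have := polarPr (-1) u 0 0; rewrite scaler0 addr0 mulN1r addNr. Qed.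

Lemma polarDr u v w : polar phi u (v + w) = polar phi u v + polar phi u w.
Proof. by have := polarPr 1 u v w; rewrite scale1r mul1r. Qed.

Lemma polarZr a u v : polar phi u (a *: v) = a * polar phi u v.
Proof. by have := polarPr a u v 0; rewrite !addr0 polar0r addr0. Qed.

Lemma polarDl u v w : polar phi (v + w) u = polar phi v u + polar phi w u.
Proof. by rewrite polarC polarDr !(polarC u). Qed.

Lemma polarZl a u v : polar phi (a *: v) u = a * polar phi v u.
Proof. by rewrite polarC polarZr (polarC u). Qed.

Lemma polar_sumr (I : Type) (r : seq I) (P : pred I) (G : I -> qspace phi) u :
  polar phi u (\sum_(i <- r | P i) G i) = \sum_(i <- r | P i) polar phi u (G i).
Proof.
by elim/big_rec2: _ => [|i x y _ <-]; rewrite ?polar0r // polarDr.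
Qed.

(** The kernel of this linear map is the orthogonal complement of the span
    of X. *)
Definition polar_row n (X : n.-tuple (qspace phi)) v : 'rV[F]_n :=
  \row_i polar phi (tnth X i) v.

Fact polar_row_linear n (X : n.-tuple (qspace phi)) : linear (polar_row X).
Proof. by move=> a u v; apply/rowP => i; rewrite !mxE polarPr. Qed.

HB.instance Definition _ n (X : n.-tuple (qspace phi)) :=
  GRing.isLinear.Build F (qspace phi) 'rV[F]_n _ (polar_row X)
    (polar_row_linear X).

Lemma polar_row0 n (X : n.-tuple (qspace phi)) v :
  polar_row X v = 0 -> {in <<X>>%VS, forall u, polar phi u v = 0}.
Proof.
move=> Xv u /coord_span ->; rewrite polarC polar_sumr big1 // => i _.
rewrite polarZr polarC -tnth_nth; move/rowP/(_ i): Xv; rewrite !mxE => ->.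
exact: mulr0.
Qed.

(** The polar form embeds U into the dual of a complement of W: a vector of U
    orthogonal to this complement is orthogonal to W as well, hence zero. *)
Lemma orthogonal_dim (U W : {vspace qspace phi}) :
    nonsingular phi -> {in U & W, forall u w, polar phi u w = 0} ->
  (\dim U + \dim W <= \dim {:qspace phi})%N.
Proof.
move=> ns oUW; have dimW := dimv_compl W; have leW := dimvS (subvf W).
pose T := linfun (polar_row (vbasis (W^C)%VS)).
have kerT : (U :&: lker T = 0)%VS.
  apply/eqP; rewrite -subv0; apply/subvP => u /memv_capP[Uu].
  rewrite memv_ker lfunE => /eqP /polar_row0 uT; rewrite memv0; apply/eqP/ns => w.
  have /memv_addP[w1 Ww1 [w2 Ww2 ->]] : w \in (W + W^C)%VS.
    by rewrite addv_complf memvf.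
  by rewrite polarDr oUW // add0r polarC uT // (span_basis (vbasisP _)).
have := limg_dim_eq kerT; have := dimvS (subvf (T @: U)).
rewrite [\dim {: 'rV_ _}]dimvf [dim _]mul1n; lia.
Qed.

End Polar.

(** For a nonsingular form a totally isotropic subspace has at most half the
    dimension, by [orthogonal_dim], so the inequality is then an equality. *)
Definition has_lagrangian phi := exists2 U : {vspace qspace phi},
  {in U, forall u, phi u = 0} & (\dim {:qspace phi} <= 2 * \dim U)%N.

Lemma lagrangian_polar phi (U : {vspace qspace phi}) :
  {in U, forall u, phi u = 0} -> {in U &, forall u v, polar phi u v = 0}.
Proof. by move=> U0 u v Uu Uv; rewrite /polar !U0 ?rpredD // !subr0. Qed.

Lemma isometric_lagrangian phi psi :
  isometric phi psi -> has_lagrangian psi -> has_lagrangian phi.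
Proof.
move=> [f [[g fK gK] fE]] [U U0 dimU]; pose h := linfun f.
have hK : cancel h g by move=> v; rewrite lfunE fK.
have limh : limg h = fullv.
  apply/eqP; rewrite eqEsubv subvf; apply/subvP => v _.
  by rewrite -[v]gK -[f _]lfunE memv_img ?memvf.
exists (h @^-1: U)%VS => [v|].
  by rewrite -memv_preim lfunE => /U0; rewrite fE.
have := limg_ker_dim h (h @^-1: U)%VS; rewrite lpreimK ?limh ?subvf //.
have := limg_ker_dim h fullv; rewrite limh.
have /eqP -> : lker h == 0%VS by apply/lker0P/(can_inj hK).
rewrite !capv0 dimv0; lia.
Qed.

Section ProductSpace.
Variables V W : vectType F.

Definition prodvs (U1 : {vspace V}) (U2 : {vspace W}) : {vspace V * W} :=
  (linfun fst @^-1: U1 :&: linfun snd @^-1: U2)%VS.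

Lemma mem_prodvs U1 U2 x : (x \in prodvs U1 U2) = (x.1 \in U1) && (x.2 \in U2).
Proof. by rewrite memv_cap -!memv_preim !lfunE. Qed.

Lemma dim_prod : \dim {:(V * W)%type} = (\dim {:V} + \dim {:W})%N.
Proof. by rewrite !dimvf. Qed.

Lemma dim_prodvs U1 U2 : (\dim U1 + \dim U2 <= \dim (prodvs U1 U2))%N.
Proof.
pose p1 : 'Hom((V * W)%type, V) := linfun fst.
pose p2 : 'Hom((V * W)%type, W) := linfun snd.
set X := prodvs U1 U2.
have le2 : (\dim U2 <= \dim (p2 @: X))%N.
  apply/dimvS/subvP => w Uw; have -> : w = p2 (0, w) by rewrite lfunE.
  by rewrite memv_img // mem_prodvs mem0v.
have le1 : (\dim U1 <= \dim (p1 @: (X :&: lker p2)))%N.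
  apply/dimvS/subvP => v Uv; have -> : v = p1 (v, 0) by rewrite lfunE.
  by rewrite memv_img // memv_cap mem_prodvs Uv mem0v memv_ker lfunE /=.
rewrite -(limg_ker_dim p2 X) -(limg_ker_dim p1 (X :&: lker p2)%VS).
exact: leq_add (leq_trans le1 (leq_addl _ _)) le2.
Qed.

End ProductSpace.

Lemma perp_lagrangian phi psi :
  has_lagrangian phi -> has_lagrangian psi -> has_lagrangian (qperp phi psi).
Proof.
move=> [U U0 dimU] [W W0 dimW]; exists (prodvs U W) => [x|].
  by rewrite mem_prodvs => /andP[/U0 x1 /W0 x2]; rewrite /= /perp_map x1 x2 addr0.
rewrite dim_prod; apply: leq_trans (leq_mul (leqnn 2) (dim_prodvs U W)).
by rewrite mulnDr leq_add.
Qed.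

(** Symplectic reduction.  Let U and M be Lagrangians of phi and of
    phi _|_ psi, and C = U _|_ psi, whose orthogonal complement is U.  The image
    of M :&: C in C / U = psi is totally isotropic.  As M + C is orthogonal to
    M :&: U, a dimension count shows that this image is large enough. *)
Lemma lagrangian_cancel phi psi :
    nonsingular (qperp phi psi) -> has_lagrangian phi ->
    has_lagrangian (qperp phi psi) ->
  has_lagrangian psi.
Proof.
move=> ns [U U0 dimU] [M M0 dimM].
pose p2 : 'Hom(qspace (qperp phi psi), qspace psi) := linfun snd.
pose C : {vspace qspace (qperp phi psi)} := prodvs U fullv.
pose D : {vspace qspace (qperp phi psi)} := prodvs U 0%VS.
exists (p2 @: (M :&: C))%VS => [_ /memv_imgP[x /memv_capP[/M0 Mx Cx] ->]|].
  move: Mx Cx; rewrite mem_prodvs lfunE /= /perp_map.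
  by move=> Mx /andP[/U0 x1 _]; rewrite x1 add0r in Mx.
have kerE : (M :&: C :&: lker p2 = M :&: D)%VS.
  rewrite -capvA; congr (_ :&: _)%VS; apply/vspaceP => x.
  by rewrite memv_cap !mem_prodvs memv_ker lfunE /= memvf memv0 andbT.
have := limg_ker_dim p2 (M :&: C)%VS; rewrite kerE => kerdim.
have orth : {in (M + C)%VS & (M :&: D)%VS, forall x y,
    polar (qperp phi psi) x y = 0}.
  move=> _ y /memv_addP[m Mm [c Cc ->]] /memv_capP[My Dy].
  rewrite polarDl (lagrangian_polar M0) // add0r.
  move: Cc Dy; rewrite !mem_prodvs memv0 => /andP[c1 _] /andP[y1 /eqP y2].
  by rewrite /= polar_perp (lagrangian_polar U0) // y2 polar0r addr0.
have arith (d i mc m c s n nu nu' nv : nat) :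
    (d + i = mc -> s + d <= n -> s + mc = m + c -> nu + nv <= c ->
     n <= 2 * m -> n = nu' + nv -> nu' <= 2 * nu -> nv <= 2 * i)%N.
  lia.
exact: (arith _ _ _ _ _ _ _ _ _ _ kerdim (orthogonal_dim ns orth)
  (dimv_sum_cap M C) (dim_prodvs U fullv) dimM (dim_prod _ _) dimU).
Qed.

End Forms.

(** * Lagrangians and hyperbolic forms *)

Section Hyp.
Variable F : fieldType.
Implicit Types phi psi : qform F.

Let hyp n := iter n (qperp (qbinary (0 : F) 0)) (qzero F).

Lemma hyperbolic_has_lagrangian phi : qhyperbolic phi -> has_lagrangian phi.
Proof.
case=> n isom; apply: isometric_lagrangian isom _.
elim: n => [|n IHn] /=.
  by exists 0%VS => [v _|]; rewrite ?dimvf.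
apply: perp_lagrangian IHn; pose e : F^o * F^o := (1, 0); exists <[e]>%VS.
  by move=> _ /vlineP[k ->]; rewrite /= /binary_map /= /GRing.scale /=; ring.
have -> : \dim {:qspace (qbinary (0 : F) 0)} = 2 by rewrite dimvf.
by rewrite dim_vline xpair_eqE oner_eq0.
Qed.

Lemma perp_nonsingular phi psi :
  nonsingular phi -> nonsingular psi -> nonsingular (qperp phi psi).
Proof.
move=> nsphi nspsi [x1 x2] x0; congr pair.
  apply: nsphi => w; have := x0 (w, 0).
  by rewrite /= polar_perp /= polar0r addr0.
apply: nspsi => w; have := x0 (0, w).
by rewrite /= polar_perp /= polar0r add0r.
Qed.

Lemma hyperbolic_sum_nonsingular n : nonsingular (hyp n).
Proof.
elim: n => [|n IHn] /=; first by move=> x _; rewrite [x]thinmx0.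
apply: perp_nonsingular IHn => -[x1 x2] x0; congr pair.
  have := x0 (0, 1); rewrite /= /polar /binary_map /= => <-; ring.
have := x0 (1, 0); rewrite /= /polar /binary_map /= => <-; ring.
Qed.

Lemma hyperbolic_sum_dim n : \dim {:qspace (hyp n)} = (2 * n)%N.
Proof.
elim: n => [|n IHn] /=; first by rewrite dimvf.
by rewrite dim_prod IHn mulnS dimvf.
Qed.

(** The statement about vectors z orthogonal to the whole family is what lets
    the induction split off the last hyperbolic pair. *)
Lemma hyperbolic_pairs_embed phi n (u w : nat -> qspace phi) :
    (forall i, (i < n)%N -> phi (u i) = 0 /\ phi (w i) = 0) ->
    (forall i j, (i < n)%N -> (j < n)%N ->
      [/\ polar phi (u i) (u j) = 0, polar phi (w i) (w j) = 0
        & polar phi (u i) (w j) = (i == j)%:R]) ->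
  exists2 g : 'Hom(qspace (hyp n), qspace phi), forall x, phi (g x) = hyp n x &
    forall z, (forall i, (i < n)%N -> polar phi z (u i) = 0 /\ polar phi z (w i) = 0) ->
      forall x, polar phi z (g x) = 0.
Proof.
elim: n => [|n IHn] quw buw.
  by exists 0 => [x|z _ x]; rewrite zero_lfunE ?qform0 ?polar0r.
have [g gq gz] : exists2 g : 'Hom(qspace (hyp n), qspace phi),
    forall x, phi (g x) = hyp n x &
    forall z, (forall i, (i < n)%N -> polar phi z (u i) = 0 /\ polar phi z (w i) = 0) ->
      forall x, polar phi z (g x) = 0.
  by apply: IHn => [i ltin|i j ltin ltjn]; [apply: quw | apply: buw]; apply: ltnW.
have [un wn] := quw n (ltnSn n).
have ug x : polar phi (u n) (g x) = 0.
  apply: gz => i ltin; have [-> _ ->] := buw n i (ltnSn n) (ltnW ltin).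
  by rewrite gtn_eqF.
have wg x : polar phi (w n) (g x) = 0.
  apply: gz => i ltin; have [_ _ uw] := buw i n (ltnW ltin) (ltnSn n).
  have [_ -> _] := buw n i (ltnSn n) (ltnW ltin).
  by rewrite polarC uw ltn_eqF.
have [_ _ unwn] := buw n n (ltnSn n) (ltnSn n); rewrite eqxx in unwn.
pose h (x : qspace (hyp n.+1)) := x.1.1 *: u n + x.1.2 *: w n + g x.2.
have [k kE] : exists k : 'Hom(qspace (hyp n.+1), qspace phi), k =1 h.
  apply: linear_lfun => a x y.
  transitivity ((a * x.1.1 + y.1.1) *: u n + (a * x.1.2 + y.1.2) *: w n
    + (a *: g x.2 + g y.2)); first by rewrite -linearP.
  rewrite !scalerDl (addrACA (_ *: u n)) [LHS]addrACA -!scalerA.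
  by rewrite -!scalerDr.
exists k => [x|z zuw x]; rewrite kE /h.
  rewrite !qformD !qformZ un wn gq !polarDl !polarZl !polarZr ug wg unwn.
  by rewrite /= /perp_map /= /binary_map; ring.
have [zu zw] := zuw n (ltnSn n).
rewrite !polarDr !polarZr zu zw gz ?mulr0 ?addr0 // => i ltin.
by apply: zuw; apply: ltnW.
Qed.

(** The map from the space to the dual of U is onto, because its kernel, being
    orthogonal to U, has dimension at most dim V - dim U. *)
Lemma isotropic_dual_basis phi (U : {vspace qspace phi}) :
    nonsingular phi -> {in U, forall v, phi v = 0} ->
  exists w : 'I_(\dim U) -> qspace phi, forall i j,
    polar phi (tnth (vbasis U) i) (w j) = (i == j)%:R.
Proof.
move=> ns U0; pose T := linfun (polar_row (vbasis U)).
have orth : {in U & lker T, forall u v, polar phi u v = 0}.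
  move=> u v Uu; rewrite memv_ker lfunE /= => /eqP /polar_row0 uv.
  by apply: uv; rewrite (span_basis (vbasisP U)).
have limT : limg T = fullv.
  apply/eqP; rewrite eqEdim subvf /=.
  have -> : \dim {:'rV[F]_(\dim U)} = \dim U by rewrite dimvf [dim _]mul1n.
  have := orthogonal_dim ns orth; rewrite -(limg_ker_dim T fullv) capfv.
  by rewrite addnC leq_add2l.
exists (fun j => (T^-1)%VF (delta_mx 0 j)) => i j.
have /rowP/(_ i) : T ((T^-1)%VF (delta_mx 0 j)) = delta_mx 0 j.
  by rewrite limg_lfunVK // limT memvf.
by rewrite lfunE /= !mxE eqxx.
Qed.

(** A dual basis w of a basis u of the Lagrangian is corrected by a triangular
    combination s of the u's so that the vectors w' = w + s are isotropic and
    mutually orthogonal; then u and w' form hyperbolic pairs. *)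
Lemma lagrangian_hyperbolic phi :
  nonsingular phi -> has_lagrangian phi -> qhyperbolic phi.
Proof.
move=> ns [U U0 dimU]; exists (\dim U).
have U0' := lagrangian_polar U0.
have dimE : \dim {:qspace phi} = (2 * \dim U)%N.
  apply/eqP; rewrite eqn_leq dimU mul2n -addnn.
  by apply: (orthogonal_dim ns) => u v Uu Uv; apply: U0'.
have [w uw] := isotropic_dual_basis ns U0.
pose u i := tnth (vbasis U) i.
have Uu i : u i \in U by rewrite vbasis_mem ?mem_tnth.
(* Triangular, since only c i k + c k i = B(w i, w k) is prescribed for i <> k;
   the diagonal entries make each w' isotropic. *)
pose c (i j : 'I_(\dim U)) := if (j < i)%N then polar phi (w i) (w j)
  else if j == i then phi (w i) else 0.
pose s i := \sum_j (- c i j) *: u j.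
have Us i : s i \in U by apply: rpred_sum => j _; apply: rpredZ.
have ws i k : polar phi (w k) (s i) = - c i k.
  rewrite polar_sumr (bigD1 k) //= polarZr polarC uw eqxx mulr1 big1 ?addr0 //.
  by move=> j /negPf jk; rewrite polarZr polarC uw jk mulr0.
pose w' i := w i + s i.
have uw' i j : polar phi (u i) (w' j) = (i == j)%:R.
  by rewrite polarDr uw U0' ?addr0.
have w'0 i : phi (w' i) = 0.
  by rewrite qformD (U0 (s i)) // addr0 ws /c ltnn eqxx subrr.
have w'w' i k : polar phi (w' i) (w' k) = 0.
  have [->|neik] := eqVneq i k.
    have -> : polar phi (w' k) (w' k) = 2%:R ^+ 2 * phi (w' k) - phi (w' k) *+ 2.
      by rewrite /polar -[w' k + w' k]mulr2n -scaler_nat qformZ mulr2n; ring.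
    by rewrite w'0 mulr0 mul0rn subrr.
  rewrite polarDl !polarDr (U0' (s i) (s k)) // (polarC (s i)) !ws /c addr0.
  have [ltik|ltki|/val_inj eik] := ltngtP i k; last by rewrite eik eqxx in neik.
    by rewrite eq_sym (negPf neik) (polarC (w k)); ring.
  by rewrite (negPf neik); ring.
have Un i : (i < \dim U)%N -> (vbasis U)`_i \in U.
  by move=> lti; rewrite vbasis_mem ?mem_nth ?size_tuple.
have [g gq _] : exists2 g : 'Hom(qspace (hyp (\dim U)), qspace phi),
    forall x, phi (g x) = hyp (\dim U) x &
    forall z, (forall i, (i < \dim U)%N -> polar phi z ((vbasis U)`_i) = 0 /\
      polar phi z (oapp w' 0 (insub i)) = 0) -> forall x, polar phi z (g x) = 0.
  apply: hyperbolic_pairs_embed => [i lti|i j lti ltj].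
    rewrite (insubT (fun i => i < \dim U)%N lti) /= w'0 U0 //.
    exact: Un.
  rewrite !(insubT (fun i => i < \dim U)%N) /=.
  have := uw' (Ordinal lti) (Ordinal ltj); rewrite /u (tnth_nth 0) => ->.
  by rewrite U0' ?w'w' //; exact: Un.
have ker0 : lker g == 0%VS.
  apply/eqP/vspaceP => x; rewrite memv_ker memv0; apply/eqP/eqP => [gx|->].
    apply: hyperbolic_sum_nonsingular => y.
    rewrite /polar -!gq; have -> : g (x + y) = g x + g y by exact: linearD.
    by rewrite gx add0r qform0 subr0 subrr.
  exact: linear0.
have limg_g : limg g = fullv.
  apply/eqP; rewrite eqEdim subvf dimE -(hyperbolic_sum_dim (\dim U)).
  by rewrite -(limg_ker_dim g fullv) (eqP ker0) capv0 dimv0 leqnn.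
exists (g^-1)%VF; split; last first.
  by move=> v; rewrite -gq limg_lfunVK ?limg_g ?memvf.
exists g => v; first by rewrite limg_lfunVK ?limg_g ?memvf.
exact: lker0_lfunK.
Qed.

End Hyp.

(** * Pfister forms *)

Section Pf.
Variable F : fieldType.
Implicit Types (phi psi : qform F) (a b c x : F).

Lemma scale_lagrangian c phi : has_lagrangian phi -> has_lagrangian (qscale c phi).
Proof.
by move=> [U U0 dimU]; exists U => // u /U0 u0; rewrite /= /scale_map u0 mulr0.
Qed.

Section Binary.
Variables (x : F) (phi : qform F).

Let psi := qtensor [tuple 1; x] phi.

Lemma qtensor2E w : psi w = phi (w ord0) + x * phi (w (lift ord0 ord0)).
Proof.
by rewrite /= /tensor_map big_ord_recl big_ord1 !(tnth_nth 0) /= mul1r.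
Qed.

Definition pair_ffun (p q : qspace phi) : qspace psi :=
  [ffun i => if i == ord0 then p else q].

Lemma qtensor2_pair p q : psi (pair_ffun p q) = phi p + x * phi q.
Proof. by rewrite qtensor2E !ffunE. Qed.

Lemma pair_ffun_eq0 p q : pair_ffun p q = 0 -> p = 0 /\ q = 0.
Proof.
move=> /ffunP pq0; have := pq0 ord0; have := pq0 (lift ord0 ord0).
by rewrite !ffunE.
Qed.

Lemma qtensor2_isometric : isometric psi (qperp phi (qscale x phi)).
Proof.
pose f (w : qspace psi) : qspace (qperp phi (qscale x phi)) :=
  (w ord0, w (lift ord0 ord0)).
have lf : linear f by move=> c u v; rewrite /f !ffunE.
pose fl : {linear qspace psi -> qspace (qperp phi (qscale x phi))} :=
  HB.pack f (GRing.isLinear.Build _ _ _ _ f lf).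
exists fl; split.
  exists (fun p => pair_ffun p.1 p.2) => [w|[p q]]; last by rewrite /= /f !ffunE.
  by apply/ffunP; case=> [[|[|//]] lti]; rewrite ffunE /=; congr (w _); apply: val_inj.
by move=> v; rewrite qtensor2E.
Qed.

Definition block_map (A B C D : 'End(qspace phi)) (w : qspace psi) : qspace psi :=
  pair_ffun (A (w ord0) + B (w (lift ord0 ord0)))
            (C (w ord0) + D (w (lift ord0 ord0))).

Lemma block_map_linear A B C D : linear (block_map A B C D).
Proof.
move=> c u v; apply/ffunP => i; rewrite !ffunE.
by case: ifP => _; rewrite !linearP addrACA -scalerDr.
Qed.

End Binary.

Definition similarity_factor phi c :=
  exists g : 'End(qspace phi), forall v, phi (g v) = c * phi v.

Lemma block_similarity x phi c (A B C D : 'End(qspace phi)) :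
    (forall p q, phi (A p + B q) + x * phi (C p + D q) = c * (phi p + x * phi q)) ->
  similarity_factor (qtensor [tuple 1; x] phi) c.
Proof.
move=> sim; have [g gE] := linear_lfun (@block_map_linear x phi A B C D).
by exists g => v; rewrite gE /block_map qtensor2_pair qtensor2E sim.
Qed.

Hypothesis char2 : 2%N \in [pchar F].

Definition round phi := forall v, phi v != 0 -> similarity_factor phi (phi v).

(** If both values are nonzero, put y = x phi(q) / phi(p), so that the value
    phi(p) + x phi(q) equals (1 + y) phi(p).  The similarity is a composite: an
    isometry from phi _|_ x phi to phi _|_ y phi, the similarity
    (u, w) |-> (u + y w, u + w) of factor 1 + y (a similarity because 2 = 0), an
    isometry back, and a similarity of phi of factor phi(p). *)
Lemma qtensor2_round x phi : round phi -> round (qtensor [tuple 1; x] phi).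
Proof.
move=> rphi v; rewrite qtensor2E; move: (v _) (v _) => {v} q p.
have [q0|q0] := eqVneq (phi q) 0.
  rewrite q0 mulr0 addr0 => /rphi[g gE].
  apply: (@block_similarity _ _ _ g 0 0 g) => u w.
  by rewrite !zero_lfunE addr0 add0r !gE; ring.
have [h hE] := rphi q q0.
have [p0|p0] := eqVneq (phi p) 0.
  rewrite p0 add0r => _; apply: (@block_similarity _ _ _ 0 (x *: h) h 0) => u w.
  by rewrite !zero_lfunE addr0 add0r !scale_lfunE qformZ !hE; ring.
move=> _; have [g gE] := rphi p p0.
(* Similarities of factors phi q / phi p and phi p / phi q, from one composite
   of factor phi p * phi q. *)
pose k := (phi p)^-1 *: (g \o h)%VF; pose l := (phi q)^-1 *: (g \o h)%VF.
have kE u : phi (k u) = phi q / phi p * phi u.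
  by rewrite scale_lfunE comp_lfunE qformZ gE hE; field.
have lE u : phi (l u) = phi p / phi q * phi u.
  by rewrite scale_lfunE comp_lfunE qformZ gE hE; field; rewrite ?p0 ?q0.
pose y := x * (phi q / phi p).
apply: (@block_similarity _ _ _ g (y *: (g \o l)%VF) (g \o k)%VF
  (g \o (k \o l))%VF) => u w.
rewrite scale_lfunE !comp_lfunE.
have -> : g u + y *: g (l w) = g (u + y *: l w) by rewrite linearD linearZ.
have -> : g (k u) + g (k (l w)) = g (k (u + l w)) by rewrite !linearD.
rewrite !gE kE.
rewrite !qformD qformZ polarZr lE.
have -> : x * phi q = y * phi p by rewrite /y; field.
transitivity (phi p * (1 + y) * (phi u + y * (phi p / phi q * phi w)) +
  phi p * (y * polar phi u (l w)) *+ 2).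
  by rewrite /y; field; rewrite ?p0 ?q0.
by rewrite -[X in _ + X]mulr_natr pcharf0 // mulr0 addr0 /y; field; rewrite ?p0 ?q0.
Qed.

(** The base case is the multiplicativity of the norm of F(i). *)
Lemma pfister_round s b : round (pfister s b).
Proof.
elim: s => [|x s IHs]; last exact: qtensor2_round.
move=> [v0 v1] _.
pose f (w : F^o * F^o) : F^o * F^o :=
  (v0 * w.1 - b * v1 * w.2, v0 * w.2 + v1 * w.1 + v1 * w.2).
have lf : linear f.
  by move=> c u w; congr pair; rewrite /= /GRing.scale /=; ring.
have [g gE] := linear_lfun lf.
by exists g => w; rewrite gE /= /binary_map /=; ring.
Qed.

Lemma graph_lagrangian x phi :
  similarity_factor phi (- x) -> has_lagrangian (qperp phi (qscale x phi)).
Proof.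
move=> [g gE].
pose f y : qspace (qperp phi (qscale x phi)) := (g y, y).
have [h hE] : exists h : 'Hom(qspace phi, qspace (qperp phi (qscale x phi))), h =1 f.
  by apply: linear_lfun => c u v; rewrite /f linearP.
exists (limg h) => [_ /memv_imgP[y _ ->]|].
  by rewrite hE /= /perp_map /= /scale_map gE mulNr addNr.
have /eqP ker0 : lker h == 0%VS.
  by apply/lker0P => u v; rewrite !hE => -[_].
have dimE : \dim (limg h) = \dim {:qspace phi}.
  by have := limg_ker_dim h fullv; rewrite ker0 capv0 dimv0.
by rewrite dimE mul2n -addnn dim_prod.
Qed.

(** For an isotropic vector (p, q) with phi(q) <> 0 one has
    - x = phi(p) / phi(q), a quotient of values of phi and hence a similarity
    factor; if phi(q) = 0, then phi itself is isotropic. *)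
Lemma qtensor2_isotropic x phi (v : qspace (qtensor [tuple 1; x] phi)) :
    round phi -> (forall u, u != 0 -> phi u = 0 -> has_lagrangian phi) ->
    v != 0 -> qtensor [tuple 1; x] phi v = 0 ->
  has_lagrangian (qtensor [tuple 1; x] phi).
Proof.
move=> rphi iphi v0; rewrite qtensor2E => qv.
apply: isometric_lagrangian (qtensor2_isometric _ _) _.
have [q0|q0] := eqVneq (phi (v (lift ord0 ord0))) 0; last first.
  apply: graph_lagrangian; have [h hE] := rphi _ q0.
  have [p0|p0] := eqVneq (phi (v ord0)) 0.
    exists 0 => u; move/eqP: qv; rewrite p0 add0r mulf_eq0 (negPf q0) orbF.
    by move/eqP->; rewrite zero_lfunE qform0 oppr0 mul0r.
  have [g gE] := rphi _ p0.
  exists ((phi (v (lift ord0 ord0)))^-1 *: (g \o h)%VF) => u.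
  rewrite scale_lfunE comp_lfunE qformZ gE hE.
  by move/eqP: qv; rewrite addr_eq0 => /eqP ->; field.
have p0 : phi (v ord0) = 0 by move: qv; rewrite q0 mulr0 addr0.
have phiL : has_lagrangian phi.
  have [v00|/iphi/(_ p0)//] := eqVneq (v ord0) 0.
  have [v10|/iphi/(_ q0)//] := eqVneq (v (lift ord0 ord0)) 0.
  case/eqP: v0; apply/ffunP; case=> [[|[|//]] lti]; rewrite ffunE.
    by rewrite -v00; congr (v _); apply: val_inj.
  by rewrite -v10; congr (v _); apply: val_inj.
exact: perp_lagrangian phiL (scale_lagrangian x phiL).
Qed.

Lemma pfister_isotropic_lagrangian s b (v : qspace (pfister s b)) :
  v != 0 -> pfister s b v = 0 -> has_lagrangian (pfister s b).
Proof.
elim: s v => [|x s IHs] v v0 qv.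
  exists <[v]>%VS => [_ /vlineP[c ->]|]; first by rewrite qformZ qv mulr0.
  by rewrite dim_vline v0 dimvf.
exact: qtensor2_isotropic (@pfister_round s b) IHs v0 qv.
Qed.

End Pf.

(** * Fourfold Pfister forms over linked fields *)

(** The given zero of the Albert form of [a, s) and [c, r) is transported along
    its embedding into <<t, s, r, a]].  If N_a is isotropic, the Pfister form is
    isotropic for that reason alone. *)
Lemma linked_pfister_isotropic (F : fieldType) (t s r a : F) :
    2%N \in [pchar F] -> linked_field F -> t != 0 -> s != 0 -> r != 0 ->
  exists2 v, v != 0 & pfister [:: t; s; r] a v = 0.
Proof.
move=> char2 linkedF t0 s0 r0.
(* mkv has the given components in the copies of N_a scaled by 1, s, r, t and
   rt, and zero components in the other three. *)
pose P1 := @pair_ffun F r (qbinary 1 a).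
pose P2 := @pair_ffun F s (pfister [:: r] a).
pose mkv (c1 cs cr ct crt : F^o * F^o) : qspace (pfister [:: t; s; r] a) :=
  @pair_ffun F t (pfister [:: s; r] a) (P2 (P1 c1 cr) (P1 cs 0))
    (P2 (P1 ct crt) (P1 0 0)).
pose N := binary_map 1 a.
have N0 : N 0 = 0 by rewrite /N /binary_map /=; ring.
have mkvE c1 cs cr ct crt : pfister [:: t; s; r] a (mkv c1 cs cr ct crt) =
    N c1 + r * N cr + s * N cs + t * (N ct + r * N crt).
  transitivity (N c1 + r * N cr + s * (N cs + r * N 0)
    + t * (N ct + r * N crt + s * (N 0 + r * N 0))).
    by rewrite /mkv /P2 /P1 !(@qtensor2_pair F).
  rewrite N0; ring.
have [[z [z0 Nz]]|aniso] := classic (exists z, z <> 0 /\ N z = 0).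
  exists (mkv z 0 0 0 0); last by rewrite mkvE Nz N0; ring.
  by apply/eqP => /pair_ffun_eq0[/pair_ffun_eq0[/pair_ffun_eq0[]]].
have {}aniso z : N z = 0 -> z = 0.
  by move=> Nz; apply: NNPP => z0; apply: aniso; exists z.
pose y := 1 + a / t; pose c := t * a * y ^+ 2.
have ty : t * y = t + a by rewrite /y; field.
have lk := linkedF _ _ (quat_quaternion_algebra a char2 s0)
  (quat_quaternion_algebra c char2 r0).
have [u [u' [v [p [q [e vp]]]]]] := linked_albert_isotropic char2 lk aniso.
(* v times the (0, y) of the plane [1, a + c], q.2 times the (1, y) of the
   plane r [1, c]. *)
exists (mkv (u + u', v) p q (0, y * v) (q.2, y * q.2)).
  apply/eqP => /pair_ffun_eq0[/pair_ffun_eq0[]].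
  move=> /pair_ffun_eq0[e1 _] /pair_ffun_eq0[p0 _] _.
  by apply: vp; rewrite p0; have /= -> := congr1 snd e1.
rewrite mkvE; case: q e => q1 q2 e /=.
have -> : s * N p = binary_map 1 c (u', v) + r * binary_map 1 c (q1, q2)
  - N (u, v) by rewrite -e [X in X - _]addrC addrK.
transitivity (2%:R * (u * u' + u' ^+ 2 + u' * v + c * v ^+ 2
  + r * (q1 ^+ 2 + q1 * q2 + (t + a + c) * q2 ^+ 2))).
  have -> : t + a = t * y by [].
  rewrite /N /binary_map /c /=.
  have -> : a = t * y - t by rewrite ty addrC addrA addNr add0r.
  ring.
by rewrite pcharf0 // mul0r.
Qed.

(** Saturation under Witt equivalence is where cancellation of Lagrangians
    is needed. *)
Lemma Iq_lagrangian (F : fieldType) phi :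
    2%N \in [pchar F] -> linked_field F -> Iq 4 phi -> @has_lagrangian F phi.
Proof.
move=> char2 linkedF.
elim=> [c [|t [|s [|r [|? ?]]]] b c0 //= /and4P[t0 s0 r0 _] _
  | | {}phi psi _ IHphi _ IHpsi | {}phi psi Iphi IHphi ns weq].
- have [v v0 qv] := linked_pfister_isotropic b char2 linkedF t0 s0 r0.
  exact/scale_lagrangian/(pfister_isotropic_lagrangian char2 v0 qv).
- by exists 0%VS => [v _|]; rewrite ?dimvf.
- exact: perp_lagrangian.
apply: (@lagrangian_cancel _ phi) IHphi _; last exact: hyperbolic_has_lagrangian.
exact: perp_nonsingular (Iq_nonsingular char2 Iphi) ns.
Qed.

Theorem theorem5p6 (F : fieldType) (char2 : 2%N \in [pchar F]%R)
    (linkedF : linked_field F) : Iq_trivial F 4.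
Proof.
move=> phi Iphi.
have I0 : Iq 4 (qperp phi (qzero F)) by apply: Iq_perp Iphi (Iq_zero _ _).
apply: lagrangian_hyperbolic; first exact: Iq_nonsingular I0.
exact: Iq_lagrangian I0.
Qed.
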